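(* Let $a,b,d$ be three pairwise coprime positive integers such that $d\notin\langle a,b\rangle$ and $d\geqslant 2$. There exist $\alpha'\in\frac1b\mathbb{Z}$ and $\alpha\in\frac1a\mathbb{Z}$ with $\alpha'-\alpha=\frac{d}{ab}$, and for any such $\alpha,\alpha'$, the multiplicity $m(\langle a,b\rangle/d)$ equals the denominator (in reduced form) of the best rational in $[\alpha,\alpha']$, i.e. the smallest positive integer $q$ such that $[\alpha,\alpha']$ contains a rational number of the form $p/q$ with $p\in\mathbb{Z}$.
   Context: $\langle a,b\rangle=\{xa+yb:x,y\in\mathbb{N}\}$. For a numerical semigroup $S\subseteq\mathbb{N}$ and a positive integer $d$, $S/d=\{x\in\mathbb{N}:dx\in S\}$. The multiplicity $m(S)$ of a numerical semigroup $S$ is its smallest positive element. The best rational in an interval is the rational in it whose reduced denominator is minimal. *)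

(* Defs.v *)
From mathcomp Require Export all_boot all_order all_algebra.

Set Implicit Arguments.
Unset Strict Implicit.
Unset Printing Implicit Defensive.

Import Order.TTheory GRing.Theory Num.Theory.

Local Open Scope ring_scope.

Definition gen2 (a b : nat) : nat -> Prop :=
  fun n => exists x y : nat, n = (x * a + y * b)%N.

Definition quot (S : nat -> Prop) (d : nat) : nat -> Prop :=
  fun x => S (d * x)%N.

Definition smallest_positive (P : nat -> Prop) (n : nat) : Prop :=
  [/\ (0 < n)%N, P n & forall k : nat, (0 < k)%N -> P k -> (n <= k)%N].

(* m(S) = m, as a relation: it asserts that the minimum exists. *)
Definition is_multiplicity (S : nat -> Prop) (m : nat) : Prop :=
  smallest_positive S m.

Definition in_invZ (c : nat) (x : rat) : Prop :=
  exists k : int, x = k%:~R / c%:R.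

(* [denq r] is the denominator of [r] in reduced form, always positive. *)
Definition best_rational (l u r : rat) : Prop :=
  l <= r <= u /\ (forall s : rat, l <= s <= u -> denq r <= denq s).

Definition has_fraction (l u : rat) (q : nat) : Prop :=
  exists p : int, l <= p%:~R / q%:R <= u.

(* Main.v *)
Require Import Defs.
From mathcomp Require Import zify ring.
Import Order.TTheory GRing.Theory Num.Theory.
Local Open Scope ring_scope.

(** Write [alpha = u/a] and [alpha' = v/b], so that [v a - u b = d].  For
    [n > 0], an integer [p] satisfies [u/a <= p/n <= v/b] iff
    [x := v n - p b] and [y := p a - u n] are nonnegative, and then
    [x a + y b = d n]; since [a] and [b] are coprime, every representation of
    [d n] arises this way.  Hence the positive elements of [<a,b>/d] are exactly
    the [n] such that [[alpha, alpha']] contains a fraction with denominator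
    [n].  The best rational is unique because two fractions with the same
    denominator [q >= 2] always enclose one with denominator [q - 1], and the
    minimal denominator is not [1] because [d] is not in [<a,b>]. *)

(** Since [a] and [b] are positive, both coefficients are at most [n], so the search is finite. The
    boolean form is what [ex_minnP] requires to extract a least element. *)
Lemma gen2P (a b n : nat) : (0 < a)%N -> (0 < b)%N ->
  reflect (gen2 a b n)
    [exists x : 'I_n.+1, exists y : 'I_n.+1, n == (x * a + y * b)%N].
Proof.
move=> a_gt0 b_gt0; apply: (iffP existsP).
  by case=> x /existsP[y /eqP def_n]; exists x, y.
case=> x [y def_n].
have lt_xn : (x < n.+1)%N by nia.
have lt_yn : (y < n.+1)%N by nia.
by exists (Ordinal lt_xn); apply/existsP; exists (Ordinal lt_yn); apply/eqP.
Qed.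

(** Cross-multiplication gives [numq r * q = p * denq r]; as [numq r] and [denq r] are coprime,
    [denq r] divides [q]. *)
Lemma denq_div_le (p : int) (q : nat) :
  (0 < q)%N -> denq (p%:~R / q%:R) <= q%:Z.
Proof.
move=> q_gt0; set r := p%:~R / q%:R.
have qN0 : (q%:R : rat) != 0 by rewrite pnatr_eq0 -lt0n.
have dN0 : ((denq r)%:~R : rat) != 0 by rewrite intr_eq0 denq_neq0.
have eq_pq : numq r * q%:Z = p * denq r.
  apply: (@intr_inj rat); rewrite !intrM.
  rewrite [(numq r)%:~R]numqE /r -pmulrn.
  by field.
have dv : (denq r %| numq r * q%:Z)%Z by rewrite eq_pq dvdz_mull.
rewrite Gauss_dvdzr in dv; last by rewrite coprimezE coprime_sym coprime_num_den.
have [k def_q] := dvdzP dv; have den_gt0 := denq_gt0 r.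
have k_gt0 : 0 < k by rewrite -(pmulr_lgt0 k den_gt0) -def_q.
by rewrite def_q ler_peMl // ltW.
Qed.

Lemma has_fraction_denq (l u s : rat) :
  l <= s <= u -> has_fraction l u `|denq s|%N.
Proof.
move=> s_lu; exists (numq s).
by rewrite pmulrn absz_denq divq_num_den.
Qed.

(* With [k = floor(p/q)], the witness is [(p - k)/q]. *)
Lemma has_fraction_pred (l u : rat) (q : nat) (p p' : int) : (0 < q)%N ->
  l <= p%:~R / q.+1%:R -> p < p' -> p'%:~R / q.+1%:R <= u ->
  has_fraction l u q.
Proof.
move=> q_gt0 l_le lt_pp' le_u.
set k := (p %/ q.+1%:Z)%Z.
have def_p : p = k * q.+1%:Z + (p %% q.+1%:Z)%Z by exact: divz_eq.
have := @modz_ge0 p q.+1%:Z isT; have := @ltz_pmod p q.+1%:Z isT.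
move: def_p; set r := (p %% _)%Z => def_p lt_rq r_ge0.
exists (p - k).
have q0 : (0 : rat) < q%:R by rewrite ltr0n.
have Q0 : (0 : rat) < q.+1%:R by rewrite ltr0n.
apply/andP; split.
  (* With denominators cleared, [(p - k) * q.+1 = p * q + r], so this bound amounts to [0 <= r]. *)
  apply: le_trans l_le _.
  rewrite ler_pdivlMr // mulrAC ler_pdivrMr // !pmulrn -!intrM ler_int.
  nia.
(* Here [p * q + r <= p' * q] is needed; it follows from [r <= q] and [p + 1 <= p']. *)
apply: le_trans le_u.
rewrite ler_pdivlMr // mulrAC ler_pdivrMr // !pmulrn -!intrM ler_int.
nia.
Qed.

Lemma coprime_int_combination (a b : nat) (d : int) : coprime a b ->
  exists u v : int, v * a%:Z - u * b%:Z = d.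
Proof.
move=> cop_ab; have /coprimezP[[x y] /= def1] : coprimez a%:Z b%:Z by [].
by exists (- y * d), (x * d); rewrite -[RHS]mul1r -def1; ring.
Qed.

Lemma quot_gen2_fraction (a b d n : nat) (u v : int) :
  (0 < a)%N -> (0 < b)%N -> (0 < n)%N -> coprime a b ->
  v * a%:Z - u * b%:Z = d%:Z ->
  quot (gen2 a b) d n <->
  has_fraction (u%:~R / a%:R) (v%:~R / b%:R) n.
Proof.
move=> a_gt0 b_gt0 n_gt0 cop_ab uvd.
have a0 : (0 : rat) < a%:R by rewrite ltr0n.
have b0 : (0 : rat) < b%:R by rewrite ltr0n.
have n0 : (0 : rat) < n%:R by rewrite ltr0n.
have cmp p : (u%:~R / a%:R <= (p%:~R / n%:R : rat) <= v%:~R / b%:R)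
    = (u * n%:Z <= p * a%:Z) && (p * b%:Z <= v * n%:Z).
  rewrite ler_pdivrMr // mulrAC ler_pdivlMr //.
  rewrite ler_pdivlMr // [X in _ && (X <= _)]mulrAC ler_pdivrMr //.
  by rewrite !pmulrn -!intrM !ler_int.
split.
  case=> x [y def_dn].
  (* This is [uvd] times [n], compared with [def_dn]. As [b] is coprime to [a], it divides
     [v * n - x], and the quotient is the numerator sought. *)
  have eq_ab : (v * n%:Z - x%:Z) * a%:Z = b%:Z * (y%:Z + u * n%:Z) by nia.
  have : (b%:Z %| (v * n%:Z - x%:Z) * a%:Z)%Z by rewrite eq_ab dvdz_mulr.
  rewrite Gauss_dvdzl; last by rewrite coprimezE coprime_sym.
  case/dvdzP=> p def_p; exists p; rewrite cmp.
  have def_pa : p * a%:Z = y%:Z + u * n%:Z.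
    have bN0 : b%:Z != 0 by lia.
    by apply: (mulfI bN0); rewrite -eq_ab def_p; ring.
  by rewrite def_pa -def_p; apply/andP; split; lia.
case=> p; rewrite cmp => /andP[le_u le_v].
(* Both integers are nonnegative by [le_v] and [le_u], so [absz] leaves their values unchanged. *)
exists (absz (v * n%:Z - p * b%:Z)%R), (absz (p * a%:Z - u * n%:Z)%R).
have xE : (absz (v * n%:Z - p * b%:Z)%R)%:Z = v * n%:Z - p * b%:Z by lia.
have yE : (absz (p * a%:Z - u * n%:Z)%R)%:Z = p * a%:Z - u * n%:Z by lia.
by apply/eqP; rewrite -eqz_nat PoszD !PoszM xE yE -uvd; apply/eqP; ring.
Qed.

(** By minimality of [m], the fraction [p / m] is already reduced. A different best rational would
    also have denominator [m], and [has_fraction_pred] would then yield the denominator [m.-1],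
    positive because [1 < m]. *)
Lemma unique_best_rational (l u : rat) (m : nat) : (1 < m)%N ->
  smallest_positive (has_fraction l u) m ->
  exists r : rat, unique (best_rational l u) r /\ denq r = m%:Z.
Proof.
move=> m_gt1 [m_gt0 [p p_lu] m_min].
have m_le s : l <= s <= u -> m%:Z <= denq s.
  move=> /has_fraction_denq; have := denq_gt0 s => s_gt0 /m_min; lia.
set r : rat := p%:~R / m%:R in p_lu.
have den_r : denq r = m%:Z.
  by apply/eqP; rewrite eq_le m_le // denq_div_le.
exists r; split=> //; split; first by split=> // s /m_le; rewrite den_r.
move=> s [s_lu s_best].
have den_s : denq s = m%:Z.
  by apply/eqP; rewrite eq_le m_le // -den_r s_best.
have no_lt (x y : rat) : l <= x <= u -> l <= y <= u -> denq x = m%:Z ->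
    denq y = m%:Z -> ~ (numq x < numq y).
  move=> /andP[l_x _] /andP[_ y_u] den_x den_y lt_xy.
  have m1 : m = m.-1.+1 by lia.
  have frac : has_fraction l u m.-1.
    apply: (@has_fraction_pred _ _ _ (numq x) (numq y)) => //; first lia.
      by rewrite -m1 pmulrn -den_x divq_num_den.
    by rewrite -m1 pmulrn -den_y divq_num_den.
  by have := m_min m.-1 _ frac; lia.
rewrite -(divq_num_den r) -(divq_num_den s) den_r den_s.
have := no_lt _ _ p_lu s_lu den_r den_s.
have := no_lt _ _ s_lu p_lu den_s den_r.
by case: (ltgtP (numq r) (numq s)) => [||->].
Qed.

Theorem theorem4 (a b d : nat)
    (a_gt0 : (0 < a)%N) (b_gt0 : (0 < b)%N) (d_ge2 : (2 <= d)%N)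
    (cop_ab : coprime a b) (cop_ad : coprime a d) (cop_bd : coprime b d)
    (d_notin : ~ gen2 a b d) :
  (exists alpha alpha' : rat,
      [/\ in_invZ b alpha', in_invZ a alpha
        & alpha' - alpha = d%:R / (a%:R * b%:R)])
  /\
  (forall alpha alpha' : rat,
      in_invZ b alpha' -> in_invZ a alpha ->
      alpha' - alpha = d%:R / (a%:R * b%:R) ->
      exists m : nat,
        [/\ is_multiplicity (quot (gen2 a b) d) m,
            exists r : rat,
              unique (best_rational alpha alpha') r /\ denq r = m%:Z
          & smallest_positive (has_fraction alpha alpha') m]).
Proof.
have aN0 : (a%:R : rat) != 0 by rewrite pnatr_eq0 -lt0n.
have bN0 : (b%:R : rat) != 0 by rewrite pnatr_eq0 -lt0n.
have difference (u v : int) :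
    v%:~R / b%:R - u%:~R / a%:R
      = (v * a%:Z - u * b%:Z)%:~R / (a%:R * b%:R) :> rat.
  by rewrite intrB !intrM -!pmulrn; field; rewrite aN0 bN0.
split.
  have [u [v uvd]] := coprime_int_combination a b d%:Z cop_ab.
  exists (u%:~R / a%:R), (v%:~R / b%:R).
  by split; [exists v | exists u | rewrite difference uvd -pmulrn].
move=> _ _ [v ->] [u ->]; rewrite difference => diff_d.
have uvd : v * a%:Z - u * b%:Z = d%:Z.
  apply: (@intr_inj rat); rewrite -pmulrn.
  by apply: (mulIf (invr_neq0 (mulf_neq0 aN0 bN0))).
pose P n := (0 < n)%N && [exists x : 'I_(d * n).+1,
  exists y : 'I_(d * n).+1, (d * n)%N == (x * a + y * b)%N].
have PP n : P n <-> (0 < n)%N /\ quot (gen2 a b) d n.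
  split=> [/andP[n_gt0 dn] | [n_gt0 dn]].
    by split=> //; apply/(gen2P a b _ a_gt0 b_gt0).
  by apply/andP; split=> //; apply/gen2P.
have exP : exists n, P n.
  (* The quotient has a positive element: [a] belongs to it, as [d * a] is a multiple of [a]. *)
  by exists a; apply/PP; split=> //; exists d, 0%N; rewrite addn0.
case: (ex_minnP exP) => m /PP[m_gt0 m_in] m_min.
have frac n n_gt0 :=
  @quot_gen2_fraction a b d n u v a_gt0 b_gt0 n_gt0 cop_ab uvd.
have m_frac : smallest_positive
    (has_fraction (u%:~R / a%:R) (v%:~R / b%:R)) m.
  split=> //; first exact/frac.
  by move=> k k_gt0 /(frac _ k_gt0) k_in; apply: m_min; apply/PP.
exists m; split=> //.
  by split=> // k k_gt0 k_in; apply: m_min; apply/PP.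
apply: unique_best_rational => //.
rewrite ltn_neqAle m_gt0 andbT; apply/eqP=> m1.
by apply: d_notin; move: m_in; rewrite -m1 /quot muln1.
Qed.
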